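(* The correspondence $F:[0,1]\to\mathcal{P}(\ell_\infty)$, $F(x)=F_1(x)\cap F_2(x)$, is V-lsc at $0$.
   Context: $\ell_\infty$ is the normed space of bounded real sequences $t=(t_1,t_2,\dots)$ with the supremum norm and $\mathcal{P}(\ell_\infty)$ is its power set. The correspondences $F_1,F_2:[0,1]\to\mathcal{P}(\ell_\infty)$ are defined by $$F_1(x)=\{t\in\ell_\infty: t_1\geq x,\ t_k\leq k-x \text{ for all integers } k\geq 2\},$$ $$F_2(x)=\left\{t\in\ell_\infty: t_1\leq 1-x,\ t_k\leq\min\left\{k(1-t_1-x),\ k+\frac{t_1}{k}-\frac{x}{k}\right\}\text{ for all integers } k\geq 2\right\}.$$ A closed-valued correspondence $H$ from a topological space $Y$ (here $Y=[0,1]$ with the usual topology) into a normed space $X$ is Vietoris-lower semicontinuous (V-lsc, also called lower hemicontinuous) at $y\in Y$ if for every open set $G\subseteq X$ with $H(y)\cap G\neq\emptyset$ there exists a neighborhood $V$ of $y$ such that $H(y')\cap G\neq\emptyset$ for all $y'\in V$. *)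

(* Defs.v *)
From HB Require Import structures.
From mathcomp Require Import all_boot all_order all_algebra.
From mathcomp Require Import all_classical all_reals.
From mathcomp Require Import topology normedtype.
Set Implicit Arguments.
Unset Strict Implicit.
Unset Printing Implicit Defensive.
Import Order.TTheory GRing.Theory Num.Theory.
Import numFieldNormedType.Exports.
Local Open Scope classical_set_scope.
Local Open Scope ring_scope.

Definition bounded_seq (R : realType) : {pred nat -> R^o} :=
  fun u => `[< bounded_fun u >].

Record linfty (R : realType) := Linfty {
  linfty_seq : nat -> R^o;
  linfty_bounded : linfty_seq \in @bounded_seq R
}.

(* The mathematical indices start at 1 while [linfty_seq] starts at 0; [coord]
   is only meaningful for [1 <= k]. *)
Definition coord (R : realType) (t : linfty R) (k : nat) : R :=
  linfty_seq t k.-1.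

Section linfty_normed_space.
Variable R : realType.

HB.instance Definition _ := [isSub for @linfty_seq R].
HB.instance Definition _ := [Choice of linfty R by <:].

Lemma bounded_seqP (u : nat -> R^o) :
  reflect (exists M, forall n, `|u n| <= M) (u \in @bounded_seq R).
Proof.
have PF : ProperFilter (globally [set: nat]).
  exact: (@globally_properfilter _ _ 0%N).
apply: (iffP (asboolP _)).
  by move=> /ex_bound[M uM]; exists M => n; exact: uM.
by move=> [M uM]; apply/ex_bound; exists M => n _; exact: uM.
Qed.

Lemma bounded_seq_submod_closed : submod_closed (@bounded_seq R).
Proof.
split=> [|a u v].
  by apply/bounded_seqP; exists 0 => n; rewrite normr0.
move=> /bounded_seqP[M uM] /bounded_seqP[N vN]; apply/bounded_seqP.
exists (`|a| * M + N) => n; rewrite (le_trans (ler_normD _ _))// lerD//.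
by rewrite normrZ ler_wpM2l.
Qed.

HB.instance Definition _ := GRing.isSubmodClosed.Build R (nat -> R^o)
  (@bounded_seq R) bounded_seq_submod_closed.
HB.instance Definition _ := [SubChoice_isSubLmodule of linfty R by <:].

Definition supnorm (t : linfty R) : R :=
  sup (range (fun n => `|linfty_seq t n|)).

Lemma supnorm_has_sup (t : linfty R) :
  has_sup (range (fun n => `|linfty_seq t n|)).
Proof.
split; first by exists `|linfty_seq t 0%N|; exists 0%N.
have /bounded_seqP[M tM] := linfty_bounded t.
by exists M => _ [n _ <-].
Qed.

Lemma le_supnorm (t : linfty R) n : `|linfty_seq t n| <= supnorm t.
Proof. by apply: ub_le_sup; [exact: (supnorm_has_sup t).2|exists n]. Qed.

Lemma supnorm_le (t : linfty R) M :
  (forall n, `|linfty_seq t n| <= M) -> supnorm t <= M.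
Proof.
move=> tM; apply: ge_sup; first exact: (supnorm_has_sup t).1.
by move=> _ [n _ <-].
Qed.

Lemma supnormD (s t : linfty R) : supnorm (s + t) <= supnorm s + supnorm t.
Proof.
apply: supnorm_le => n; rewrite (le_trans (ler_normD _ _))//.
by rewrite lerD// le_supnorm.
Qed.

Lemma supnormZ (a : R) (t : linfty R) : supnorm (a *: t) = `|a| * supnorm t.
Proof.
have supnormZ_le b s : supnorm (b *: s) <= `|b| * supnorm s.
  by apply: supnorm_le => n; rewrite normrZ ler_wpM2l// le_supnorm.
apply/eqP; rewrite eq_le supnormZ_le/=.
have [->|a0] := eqVneq a 0.
  by rewrite normr0 mul0r (le_trans _ (le_supnorm _ 0%N)).
rewrite -ler_pdivlMl ?normr_gt0// -normfV.
by rewrite -[in leLHS](scalerK a0 t) supnormZ_le.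
Qed.

Lemma supnorm_eq0 (t : linfty R) : supnorm t = 0 -> t = 0.
Proof.
move=> t0; apply/val_inj/funext => n; apply/eqP.
by rewrite -normr_le0 -t0 le_supnorm.
Qed.

HB.instance Definition _ := Lmodule_isNormed.Build R (linfty R)
  supnormD supnormZ supnorm_eq0.

End linfty_normed_space.

Record closed_corr (R : realType) (Y : topologicalType) (X : normedModType R) :=
    ClosedCorr {
  corr :> Y -> set X;
  corr_closed : forall y, closed (corr y)
}.

Definition Vlsc_at (R : realType) (Y : topologicalType) (X : normedModType R)
    (H : closed_corr Y X) (y : Y) : Prop :=
  forall G : set X, open G -> H y `&` G !=set0 ->
    exists2 V : set Y, nbhs y V & forall y', V y' -> H y' `&` G !=set0.

(* As a [set_type], [I01 R] carries the topology induced by [R]. *)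
Notation I01 R := (set_type `[0 : R, 1 : R]%classic).

Lemma I01_0_subproof (R : realType) : (0 : R) \in `[0 : R, 1 : R]%classic.
Proof. by rewrite mem_setE bound_itvE. Qed.

Definition I01_0 (R : realType) : I01 R := exist _ 0 (I01_0_subproof R).

Section correspondences.
Variable R : realType.

Definition F1 (x : I01 R) : set (linfty R) :=
  [set t | coord t 1%N >= \val x /\
           forall k : nat, (2 <= k)%N -> coord t k <= k%:R - \val x].

Definition F2 (x : I01 R) : set (linfty R) :=
  [set t | coord t 1%N <= 1 - \val x /\
           forall k : nat, (2 <= k)%N ->
             coord t k <= Num.min (k%:R * (1 - coord t 1%N - \val x))
                                  (k%:R + coord t 1%N / k%:R - \val x / k%:R)].

Lemma coord_continuous k : continuous (fun t : linfty R => coord t k).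
Proof.
move=> t; apply/(@cvgrPdist_le _ _ _ (nbhs t)) => e e0.
have := @nbhsx_ballx _ _ t e e0.
apply: filterS => s; rewrite -ball_normE/= => /ltW; apply: le_trans.
exact: (le_supnorm (t - s) k.-1).
Qed.

Lemma F_closed (x : I01 R) : closed (F1 x `&` F2 x).
Proof.
have closed_le (f g : linfty R -> R) : continuous f -> continuous g ->
    closed [set t | f t <= g t].
  move=> cf cg.
  rewrite (_ : mkset _ = (g \- f) @^-1` [set r | 0 <= r]).
    apply: preimage_closed; last exact: closed_ge.
    by move=> t _; apply: (@continuousB _ R^o _ g f t); [exact: cg|exact: cf].
  by apply/seteqP; split => t /=; rewrite subr_ge0.
have closed_forall (P : nat -> Prop) (Q : nat -> set (linfty R)) :
    (forall k, closed (Q k)) -> closed [set t | forall k, P k -> Q k t].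
  move=> cQ; rewrite (_ : mkset _ = \bigcap_(k in [set k | P k]) Q k)//.
  by apply: closed_bigI => k _; exact: cQ.
have cc k := @coord_continuous k.
have cst r : continuous (fun _ : linfty R => r : R) by exact: cst_continuous.
apply: closedI; apply: closedI.
- exact: closed_le (cst _) (cc _).
- by apply: closed_forall => k; exact: closed_le (cc _) (cst _).
- exact: closed_le (cc _) (cst _).
- apply: closed_forall => k; apply: closed_le => [|t]; first exact: cc.
  apply: (@continuous_min _ _ (fun t => k%:R * (1 - coord t 1%N - \val x))
    (fun t => k%:R + coord t 1%N / k%:R - \val x / k%:R)).
    apply: continuousM; first exact: cst.
    apply: continuousB; last exact: cst.
    by apply: continuousB; [exact: cst|exact: cc].
  apply: continuousB; last exact: cst.
  apply: continuousD; first exact: cst.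
  by apply: continuousM; [exact: cc|exact: cst].
Qed.

Definition F : closed_corr (I01 R) (linfty R) :=
  @ClosedCorr R (I01 R) (linfty R) (fun x => F1 x `&` F2 x) F_closed.

End correspondences.

(* Main.v *)
(** The inequalities defining [F] are affine in [(x, t)], so its graph is
    convex.  Hence for [t] in [F 0] the segment from [(0, t)] to [(1/2, w)],
    where [w = (1/2, 0, 0, ...)] lies in [F (1/2)], stays in the graph; its
    point above [x] is [t + 2 x (w - t)], which tends to [t] as [x] tends
    to [0]. *)

Require Import Defs.
From mathcomp Require Import all_boot all_order all_algebra.
From mathcomp Require Import all_classical all_reals.
From mathcomp Require Import topology normedtype.
From mathcomp Require Import lra.
Import Order.TTheory GRing.Theory Num.Theory.
Import numFieldNormedType.Exports.
Local Open Scope classical_set_scope.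
Local Open Scope ring_scope.

(* [vector.coord] would otherwise be found first. *)
Local Notation coord := Defs.coord.

(** Index 0 stands for the mathematical index 1. At [x = 1/2] the constraints force [t_1 = 1/2],
    hence [t_k <= 0] for [k >= 2]; this sequence attains these bounds. *)
Definition half_first (R : realType) (n : nat) : R^o :=
  if n == 0%N then 2^-1 else 0.

Lemma half_first_bounded (R : realType) :
  half_first R \in @bounded_seq R.
Proof.
apply/bounded_seqP; exists 1 => n; rewrite /half_first.
by case: eqP => _; rewrite ?normr0 // ger0_norm; lra.
Qed.

Definition apex (R : realType) : linfty R :=
  @Linfty R _ (half_first_bounded R).

Lemma coord_segment (R : realType) (t w : linfty R) (a : R) (k : nat) :
  coord (t + a *: (w - t)) k = coord t k + a * (coord w k - coord t k).
Proof. by []. Qed.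

(** As [x <= 1/2], the weight [1 - 2 x] of [t] is nonnegative, so the constraints on [t] at 0 may be
    scaled by it. *)
Lemma segment_F (R : realType) (t : linfty R) (x : I01 R) :
  F R (I01_0 R) t -> \val x <= 2^-1 ->
  F R x (t + (2 * \val x) *: (apex R - t)).
Proof.
have r0 : 0 <= \val x by have := set_valP x; rewrite /= in_itv /= => /andP[].
have [r rE] : exists r, \val x = r by exists (\val x).
rewrite rE in r0 *.
move=> [[/= t1ge _] [/= t1le tk]] rle.
have s1 : coord (t + (2 * r) *: (apex R - t)) 1 =
    (1 - 2 * r) * coord t 1 + r.
  by rewrite coord_segment /coord /= /half_first /=; lra.
have sk k : (2 <= k)%N -> coord (t + (2 * r) *: (apex R - t)) k =
    (1 - 2 * r) * coord t k.
  case: k => [|[|k]] // _.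
  by rewrite coord_segment /coord /= /half_first /=; lra.
have s1r : r <= (1 - 2 * r) * coord t 1 + r by nra.
(* The right side equals [k (1 - 2 r) (1 - t_1)]: this is [t_k <= k (1 - t_1)] scaled by
   [1 - 2 r]. *)
have bound k : (2 <= k)%N -> (1 - 2 * r) * coord t k <=
    k%:R * (1 - ((1 - 2 * r) * coord t 1 + r) - r).
  move=> /tk; rewrite le_min => /andP[+ _]; nra.
have k2 k : (2 <= k)%N -> 2 <= k%:R :> R by rewrite ler_nat.
rewrite /= /F1 /F2 /mkset rE s1; split; split.
- exact: s1r.
- move=> k kge; rewrite sk //; apply: (le_trans (bound k kge)).
  (* By [s1r] the bound is at most [k (1 - 2 r)], hence at most [k - r]. *)
  have := k2 k kge; nra.
- nra.
- move=> k kge; rewrite sk // le_min bound //=.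
  apply: (le_trans (bound k kge)).
  have kge' := k2 k kge.
  (* By this sign the second term of the minimum is at least [k], which dominates [bound]. *)
  have : 0 <= ((1 - 2 * r) * coord t 1 + r - r) / k%:R.
    by apply: divr_ge0; lra.
  rewrite mulrBl; nra.
Qed.

Lemma cvg_segment (R : realType) (V : normedModType R) (t d : V) :
  t + (2 * r) *: d @[r --> (0 : R)] --> t.
Proof.
(* Writing the limit as [t + (2 * 0) *: d] lets the limit rules apply termwise. *)
rewrite -[X in _ --> X]addr0 -[X in _ --> _ + X](scale0r d) -{2}(mulr0 2).
apply: cvgD; first exact: cvg_cst.
by apply: cvgZr_tmp; exact: cvgMl_tmp.
Qed.

Theorem proposition3p8 (R : realType) : Vlsc_at (F R) (I01_0 R).
Proof.
move=> G oG [t [Ft Gt]].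
have valc : (fun x : I01 R => \val x) @ I01_0 R --> (0 : R).
  exact: (@initial_continuous _ _ _ (I01_0 R)).
have segc := cvg_comp _ _ valc (cvg_segment R _ t (apex R - t)).
exists [set x : I01 R | \val x < 2^-1 /\
    G (t + (2 * \val x) *: (apex R - t))].
  apply: filterI.
    by apply: (valc [set r | r < 2^-1]); apply: lt_nbhsl; lra.
  by apply: (segc G); exact: open_nbhs_nbhs.
move=> x [xlt Gx]; exists (t + (2 * \val x) *: (apex R - t)).
by split => //; apply: segment_F => //; exact: ltW.
Qed.
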